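(* Suppose $S=\emptyset$, i.e., $\bar u_i>0$ for all $i\in[n]$. Let $z(u)=Du+r$ with $D\in\mathbb{R}^{n\times n}$ and $r\in\mathbb{R}^n$, and let $J=\{i\in[n]\setminus[h] : r_i\neq 0\}$ and $N=\{i\in[n]: r_i=0\}$. Then $z(u)=Du+r$ is an AAR solution of the uncertain LCP $$0\le z(u)\perp Mz(u)+q(u)\ge 0\quad\text{for all } u\in\mathcal{U}$$ if and only if $D$ and $r$ are given by $$D_J=-(M_J)^{-1},\quad D_{J,i}=0,\ D_{i,\cdot}=0 \text{ for all } i\notin J,$$ $$r_J=-(M_J)^{-1}\bar q_J,\quad r_i=0\text{ for all } i\notin J,$$ and the following conditions are fulfilled: (a) $M_J$ is invertible; (b) $-(M_J)^{-1}q_J(u)\ge 0$ for all $u\in\mathcal{U}$; (c) $-M_{N,J}(M_J)^{-1}q_J(u)+q_N(u)\ge 0$ for all $u\in\mathcal{U}$.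
   Context: Notation: $[n]=\{1,\dots,n\}$ and $[h]=\{1,\dots,h\}$ ($[0]=\emptyset$). For a matrix $A$ and index sets $I,J$, $A_{I,J}$ is the submatrix with rows in $I$ and columns in $J$, $A_I=A_{I,I}$, $A_{i,\cdot}$ is the $i$-th row and $A_{\cdot,j}$ the $j$-th column; $b_I$ is the subvector of $b$ indexed by $I$ (and $q_J(u)=(q(u))_J$). Vector inequalities are componentwise, and $0\le a\perp b\ge 0$ means $a\ge0$, $b\ge0$, $a^\top b=0$. Data: $M\in\mathbb{R}^{n\times n}$, $\bar q\in\mathbb{R}^n$, $\bar u\in\mathbb{R}^n_{\ge0}$, $h\in\{0,\dots,n\}$. The uncertainty set is the box $\mathcal{U}=\{u\in\mathbb{R}^n: -\bar u_i\le u_i\le \bar u_i,\ i\in[n]\}$, and $q(u)=\bar q+u$ for $u\in\mathcal{U}$. Let $U=\{i\in[n]:\bar u_i>0\}$ and $S=\{i\in[n]:\bar u_i=0\}$. An affinely adjustable robust (AAR) solution of the uncertain LCP is an affine function $z(u)=Du+r$ with $D\in\mathbb{R}^{n\times n}$, $r\in\mathbb{R}^n$, $D_{[h],\cdot}=0$ (the first $h$ variables are non-adjustable) and, by convention, $D_{\cdot,S}=0$, such that $0\le z(u)\perp Mz(u)+q(u)\ge0$ for all $u\in\mathcal{U}$. *)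

(* Defs.v *)
From HB Require Import structures.
From mathcomp Require Import all_boot all_order all_algebra.
From mathcomp Require Import reals.

Set Implicit Arguments.
Unset Strict Implicit.
Unset Printing Implicit Defensive.

Import Order.TTheory GRing.Theory Num.Theory.
Local Open Scope ring_scope.

(* [A_{I,J}]; the rows and columns keep the order of the indices, and index
   sets may be empty (the 0 x 0 matrix is invertible). *)
Definition mxset (R : Type) (m n : nat) (I : {set 'I_m}) (J : {set 'I_n})
    (A : 'M[R]_(m, n)) : 'M[R]_(#|I|, #|J|) :=
  mxsub (fun i : 'I_#|I| => enum_val i) (fun j : 'I_#|J| => enum_val j) A.

Definition cvset (R : Type) (n : nat) (I : {set 'I_n}) (b : 'cV[R]_n) :
    'cV[R]_#|I| :=
  rowsub (fun i : 'I_#|I| => enum_val i) b.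

Definition cv_ge0 (R : realType) (n : nat) (a : 'cV[R]_n) : Prop :=
  forall i, 0 <= a i 0.

Definition complementary (R : realType) (n : nat) (a b : 'cV[R]_n) : Prop :=
  [/\ cv_ge0 a, cv_ge0 b & a^T *m b = 0].

(* Indices are 0-based: [{1, ..., h}] becomes [{0, ..., h-1}]. *)
Definition first_indices (n h : nat) : {set 'I_n} := [set i : 'I_n | (i < h)%N].

Definition box (R : realType) (n : nat) (ubar u : 'cV[R]_n) : Prop :=
  forall i, - ubar i 0 <= u i 0 <= ubar i 0.

Definition certain_indices (R : realType) (n : nat) (ubar : 'cV[R]_n) :
    {set 'I_n} :=
  [set i | ubar i 0 == 0].

Definition affine (R : realType) (n : nat) (D : 'M[R]_n) (r u : 'cV[R]_n) :
    'cV[R]_n :=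
  D *m u + r.

Definition qfun (R : realType) (n : nat) (qbar u : 'cV[R]_n) : 'cV[R]_n :=
  qbar + u.

(* The affine function [z(u) = D u + r], represented by [(D, r)], is an affinely
   adjustable robust solution; the first [h] variables are non-adjustable, and
   the columns of [D] at certain indices vanish by convention. *)
Definition AAR_solution (R : realType) (n : nat) (M : 'M[R]_n)
    (qbar ubar : 'cV[R]_n) (h : nat) (D : 'M[R]_n) (r : 'cV[R]_n) : Prop :=
  [/\ forall i, i \in first_indices n h -> row i D = 0,
      forall j, j \in certain_indices ubar -> col j D = 0
    & forall u, box ubar u ->
        complementary (affine D r u) (M *m affine D r u + qfun qbar u)].

(* Main.v *)
(* Nonnegativity of z_i on the box, which is symmetric about 0, forces row i of D
   to vanish when r_i = 0.  When r_i != 0, complementarity forces the affine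
   function w_i(u) = (M z(u) + q(u))_i to vanish identically, that is,
   (M D + I)_i = 0 and (M r + qbar)_i = 0.  Put P = {i | r_i != 0}.  Rows of D
   outside J are zero, so M_{P,J} D_{J,P} = - I_P; by rank #|P| <= #|J|, hence
   P = J, and M_J D_J = - I_J makes M_J invertible. *)

Require Import Defs.
From HB Require Import structures.
From mathcomp Require Import all_boot all_order all_algebra.
From mathcomp Require Import reals.

Set Implicit Arguments.
Unset Strict Implicit.
Unset Printing Implicit Defensive.

Import Order.TTheory GRing.Theory Num.Theory.
Local Open Scope ring_scope.

(** The middle sum loses its terms outside [J], so it runs over [J] only. The hypothesis bears on
    products because the vanishing factor is sometimes the left one and sometimes the right one. *)
Lemma mul_mxsub_supported (R : pzRingType) (m n p m' p' : nat)
    (f : 'I_m' -> 'I_m) (g : 'I_p' -> 'I_p) (J : {set 'I_n})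
    (A : 'M[R]_(m, n)) (B : 'M[R]_(n, p)) :
  (forall i j k, k \notin J -> A (f i) k * B k (g j) = 0) ->
  mxsub f (fun k : 'I_#|J| => enum_val k) A
    *m mxsub (fun k : 'I_#|J| => enum_val k) g B = mxsub f g (A *m B).
Proof.
move=> AB0; apply/matrixP => i j; rewrite !mxE (bigID (mem J)) /=.
rewrite [X in _ + X]big1 => [|k /AB0->//]; rewrite addr0 [RHS]big_enum_val.
by apply: eq_bigr => k _; rewrite !mxE.
Qed.

Lemma mxset1 (R : pzRingType) (n : nat) (I : {set 'I_n}) :
  mxset I I (1%:M : 'M[R]_n) = 1%:M.
Proof. by apply/matrixP => i j; rewrite !mxE (inj_eq enum_val_inj). Qed.

(** A sum of nonnegative terms is zero only if every term is. *)
Lemma complementaryP (R : realType) (n : nat) (a b : 'cV[R]_n) :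
  complementary a b <->
  forall i, [/\ 0 <= a i 0, 0 <= b i 0 & a i 0 * b i 0 = 0].
Proof.
split=> [[a0 b0 ab] i|H].
  split=> //; have /eqP : (a^T *m b) 0 0 = 0 by rewrite ab mxE.
  rewrite mxE psumr_eq0 => [|k _]; last by rewrite mxE mulr_ge0.
  by move=> /allP/(_ i (mem_index_enum _))/eqP; rewrite mxE.
split=> [i|i|]; try by case: (H i).
apply/matrixP => i j; rewrite !ord1 !mxE big1 // => k _.
by rewrite mxE; case: (H k).
Qed.

(** Scaled unit vectors serve as the test points from which single coefficients are extracted. *)
Lemma affine_delta (R : realType) (n : nat) (D : 'M[R]_n) (r : 'cV[R]_n)
    (t : R) (i j : 'I_n) :
  affine D r (t *: delta_mx j 0) i 0 = t * D i j + r i 0.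
Proof. by rewrite /affine -scalemxAr -colE !mxE. Qed.

Lemma box_delta (R : realType) (n : nat) (ubar : 'cV[R]_n) (t : R)
    (j : 'I_n) :
  cv_ge0 ubar -> `|t| <= ubar j 0 -> box ubar (t *: delta_mx j 0).
Proof.
move=> u0 tj i; rewrite !mxE eqxx andbT -ler_norml.
by case: eqP => [->|_]; rewrite ?mulr1 ?mulr0 ?normr0.
Qed.

(** At [u] equal to plus or minus [ubar j 0] times the [j]-th unit vector, the value is [D i j]
    times numbers of both signs, so [D i j] is zero. *)
Lemma ge0_on_box_row0 (R : realType) (n : nat) (ubar : 'cV[R]_n)
    (D : 'M[R]_n) (r : 'cV[R]_n) (i : 'I_n) :
  (forall j, 0 < ubar j 0) ->
  (forall u, box ubar u -> 0 <= affine D r u i 0) ->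
  r i 0 = 0 -> row i D = 0.
Proof.
move=> u_gt0 z_ge0 ri0; have u_ge0 : cv_ge0 ubar by move=> j; apply: ltW.
apply/rowP => j; rewrite !mxE; apply/eqP.
have zj t : `|t| = ubar j 0 -> 0 <= t * D i j.
  move=> tu; rewrite -[_ * _]addr0 -[X in _ + X]ri0 -affine_delta.
  by apply: z_ge0; apply: box_delta; rewrite ?tu.
rewrite eq_le -(pmulr_rge0 _ (u_gt0 j)) -oppr_ge0 -(pmulr_rge0 _ (u_gt0 j)).
by rewrite mulrN -mulNr !zj ?normrN ?gtr0_norm.
Qed.

(** At [u = 0] the product is [r i 0 * s i 0], whence [s i 0 = 0]. If [E i j] were nonzero, the
    first factor would vanish at both ends of the [j]-th axis of the box, and so would the mean of
    these two values, which is [r i 0]. *)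
Lemma mul_affine0_on_box (R : realType) (n : nat) (ubar : 'cV[R]_n)
    (D E : 'M[R]_n) (r s : 'cV[R]_n) (i : 'I_n) :
  (forall j, 0 < ubar j 0) ->
  (forall u, box ubar u -> affine D r u i 0 * affine E s u i 0 = 0) ->
  r i 0 != 0 -> row i E = 0 /\ s i 0 = 0.
Proof.
move=> u_gt0 zw0 ri; have u_ge0 : cv_ge0 ubar by move=> j; apply: ltW.
have zw t j : `|t| <= ubar j 0 -> (t * D i j + r i 0) * (t * E i j + s i 0) = 0.
  by move=> tu; rewrite -!affine_delta; apply/zw0/box_delta.
have si : s i 0 = 0.
  have := zw 0 i; rewrite normr0 !mul0r !add0r => /(_ (u_ge0 i))/eqP.
  by rewrite mulf_eq0 (negPf ri) => /eqP.
split=> //; apply/rowP => j; rewrite !mxE; apply/eqP.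
have uj := lt0r_neq0 (u_gt0 j); apply: contraNT ri => Eij.
have zero t : `|t| = ubar j 0 -> t * D i j + r i 0 = 0.
  move=> tu; have t0 : t != 0 by rewrite -normr_eq0 tu.
  have := zw t j; rewrite tu lexx si addr0 => /(_ isT)/eqP.
  by rewrite !mulf_eq0 (negPf t0) (negPf Eij) !orbF => /eqP.
have p := zero _ (gtr0_norm (u_gt0 j)).
have m : - ubar j 0 * D i j + r i 0 = 0 by rewrite zero ?normrN ?gtr0_norm.
have : r i 0 *+ 2 = 0.
  by rewrite mulr2n -{1}[r i 0](addKr (ubar j 0 * D i j)) p addr0 -mulNr m.
by move/eqP; rewrite mulrn_eq0.
Qed.

Lemma LCP_residual_affine (R : realType) (n : nat) (M D : 'M[R]_n)
    (qbar r u : 'cV[R]_n) :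
  M *m affine D r u + qfun qbar u = affine (M *m D + 1%:M) (M *m r + qbar) u.
Proof.
by rewrite /affine /qfun mulmxDr mulmxA mulmxDl mul1mx [qbar + u]addrC addrACA.
Qed.

Theorem theorem1 (R : realType) (n : nat) (M : 'M[R]_n) (qbar ubar : 'cV[R]_n)
    (h : nat) (h_le_n : (h <= n)%N) (ubar_ge0 : cv_ge0 ubar)
    (S_empty : certain_indices ubar = set0)
    (D : 'M[R]_n) (r : 'cV[R]_n) (J N : {set 'I_n})
    (J_def : J = [set i in ~: first_indices n h | r i 0 != 0])
    (N_def : N = [set i | r i 0 == 0]) :
  AAR_solution M qbar ubar h D r <->
  ([/\ mxset J J D = - invmx (mxset J J M),
       (forall i, i \notin J -> cvset J (col i D) = 0 /\ row i D = 0),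
       cvset J r = - (invmx (mxset J J M) *m cvset J qbar)
     & (forall i, i \notin J -> r i 0 = 0)]
   /\
   [/\ mxset J J M \in unitmx,
       (forall u, box ubar u ->
          cv_ge0 (- (invmx (mxset J J M) *m cvset J (qfun qbar u))))
     & (forall u, box ubar u ->
          cv_ge0 (- (mxset N J M *m invmx (mxset J J M)
                       *m cvset J (qfun qbar u))
                  + cvset N (qfun qbar u)))]).
Proof.
have u_gt0 j : 0 < ubar j 0.
  rewrite lt0r ubar_ge0 andbT; apply/negP => uj.
  by have := in_set0 j; rewrite -S_empty inE uj.
(* Both directions use this formula: it turns (b) into [z_J(u) >= 0] and, with [wN], (c) into
   nonnegativity of the residual on [N]. *)
have zJ u : (forall i j, j \notin J -> i \in J -> D i j = 0) ->
    mxset J J D = - invmx (mxset J J M) ->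
    cvset J r = - (invmx (mxset J J M) *m cvset J qbar) ->
    cvset J (affine D r u) = - (invmx (mxset J J M) *m cvset J (qfun qbar u)).
  move=> D0 DJ rJ; have -> : cvset J (affine D r u) = cvset J (D *m u) + cvset J r.
    by apply/matrixP => i j; rewrite !mxE.
  rewrite rJ -[cvset J (D *m u)](@mul_mxsub_supported _ _ _ _ _ _ _ id J).
    have -> : cvset J (qfun qbar u) = cvset J qbar + cvset J u.
      by apply/matrixP => i j; rewrite !mxE.
    by rewrite -/(mxset J J D) DJ mulNmx mulmxDr opprD addrC.
  by move=> i j k kJ; rewrite D0 ?mul0r ?enum_valP.
have wN (I : {set 'I_n}) u : (forall i, i \notin J -> affine D r u i 0 = 0) ->
    cvset I (M *m affine D r u + qfun qbar u) =
    mxset I J M *m cvset J (affine D r u) + cvset I (qfun qbar u).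
  move=> z0; rewrite (@mul_mxsub_supported _ _ _ _ _ _ _ id J) => [|i j k kJ].
    by apply/matrixP => i j; rewrite !mxE.
  by rewrite ord1 z0 ?mulr0.
have z0 u : (forall i, i \notin J -> row i D = 0) ->
    (forall i, i \notin J -> r i 0 = 0) ->
    forall i, i \notin J -> affine D r u i 0 = 0.
  move=> rD r0 i iJ; rewrite /affine mxE r0 // addr0.
  by have /rowP/(_ 0) := row_mul i D u; rewrite rD // mul0mx !mxE.
split=> [[Dh _ sol]|[[DJ D0 rJ r0] [MJ zge wge]]]; last first.
  (* Sufficiency. On [J] the residual cancels and (b) gives the sign of [z]; off [J], [z] vanishes,
     the index lies in [N], and (c) gives the sign of the residual. *)
  split=> [i ih|j|u uU].
  - by apply: (D0 i _).2; move: ih; rewrite J_def !inE => ->.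
  - by rewrite S_empty inE.
  have zu0 := z0 u (fun i iJ => (D0 i iJ).2) r0.
  have zuJ : cvset J (affine D r u) =
      - (invmx (mxset J J M) *m cvset J (qfun qbar u)).
    apply: zJ => // i j /D0[/matrixP/(_ _ 0) c0 _] iJ.
    by have := c0 (enum_rank_in iJ i); rewrite !mxE enum_rankK_in.
  apply/complementaryP => i; have [iJ|iJ] := boolP (i \in J).
    have -> : (M *m affine D r u + qfun qbar u) i 0 = 0.
      have /matrixP/(_ (enum_rank_in iJ i) 0) := wN J u zu0.
      by rewrite zuJ mulmxN mulmxA mulmxV // mul1mx addNr !mxE enum_rankK_in.
    rewrite mulr0 lexx; split=> //.
    have := zge u uU (enum_rank_in iJ i).
    by rewrite -zuJ !mxE enum_rankK_in.
  have iN : i \in N by rewrite N_def inE r0.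
  rewrite zu0 // mul0r lexx; split=> //.
  have := wge u uU (enum_rank_in iN i).
  by rewrite -mulmxA -mulmxN -zuJ -wN // [cvset _ _ _ _]mxE enum_rankK_in.
(* Necessity, starting from the componentwise form of the conditions. *)
have {}sol u : box ubar u -> forall i, [/\ 0 <= affine D r u i 0,
    0 <= (M *m affine D r u + qfun qbar u) i 0 &
    affine D r u i 0 * (M *m affine D r u + qfun qbar u) i 0 = 0].
  by move=> /sol/complementaryP.
have rowD0 i : i \notin J -> row i D = 0.
  rewrite J_def !inE negb_and !negbK => /orP[ih|/eqP ri0].
    by apply: Dh; rewrite inE.
  by apply: ge0_on_box_row0 ri0 => // u /sol/(_ i)[].
have D0 i j : i \notin J -> D i j = 0.
  by move=> /rowD0/rowP/(_ j); rewrite !mxE.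
have res0 i : i \notin N -> row i (M *m D + 1%:M) = 0 /\ (M *m r + qbar) i 0 = 0.
  rewrite N_def inE => ri; apply: (mul_affine0_on_box (D := D) u_gt0 _ ri) => u uU.
  by rewrite -LCP_residual_affine; case: (sol u uU i).
have MD i j : i \notin N -> (M *m D) i j = - (i == j)%:R.
  move=> /res0[/rowP/(_ j) + _]; rewrite !mxE => /eqP.
  by rewrite addr_eq0 => /eqP.
have MJD m (K : {set 'I_n}) (g : 'I_m -> 'I_n) :
    mxset K J M *m mxsub (fun i => enum_val i) g D =
    mxsub (fun i => enum_val i) g (M *m D).
  by apply: mul_mxsub_supported => i j k /D0->; rewrite mulr0.
(* One inclusion is the definition of [J]; the other follows by counting, since a product with inner
   dimension [#|J|] has rank at most [#|J|]. In particular [r] vanishes at every non-adjustable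
   index. *)
have JP : J = ~: N.
  apply/eqP; rewrite eqEcard; apply/andP; split.
    by apply/subsetP => i; rewrite J_def N_def !inE => /andP[].
  have <- : \rank (mxset (~: N) J M *m mxset J (~: N) D) = #|~: N|.
    rewrite MJD; transitivity (\rank (- (1%:M : 'M[R]_#|~: N|))).
      congr (\rank _); apply/matrixP => i j; have := enum_valP i.
      by rewrite inE mxE => /MD->; rewrite !mxE (inj_eq enum_val_inj).
    by rewrite mxrank_opp mxrank1.
  exact: mulmx_max_rank.
have JN i : i \in J -> i \notin N by rewrite JP inE.
have r0 i : i \notin J -> r i 0 = 0.
  by rewrite JP N_def !inE negbK => /eqP.
(* For square matrices a one-sided inverse suffices, so this identity yields both (a) and the
   formula for [D_J]. *)
have MDJ : mxset J J M *m - mxset J J D = 1%:M.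
  rewrite mulmxN MJD -mxset1; apply/matrixP => i j.
  by rewrite mxE [X in - X]mxE MD ?JN ?enum_valP // !mxE opprK.
have [MJ _] := mulmx1_unit MDJ.
have DJ : mxset J J D = - invmx (mxset J J M).
  by rewrite -[invmx _]mulmx1 -MDJ mulKmx // opprK.
(* The rows of [M *m D] in [J] are those of minus the identity, so [M_J D_{J,i} = 0] for [i] outside
   [J]; then [M_J] is cancelled. *)
have DJ0 i : i \notin J -> cvset J (col i D) = 0.
  move=> iJ; rewrite -[LHS](mulKmx MJ) [X in _ *m X](_ : _ = 0) ?mulmx0 //.
  have -> : cvset J (col i D) = mxsub (fun k => enum_val k) (fun _ : 'I_1 => i) D.
    by apply/matrixP => k l; rewrite !mxE.
  rewrite MJD; apply/matrixP => k l; have kJ := enum_valP k.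
  rewrite mxE MD ?JN // mxE; case: eqP => [ki|_]; last by rewrite oppr0.
  by rewrite -ki kJ in iJ.
(* Since [r] is supported on [J], the zero constant term of the residual on [J] reads
   [M_J r_J = - qbar_J]. *)
have rJ : cvset J r = - (invmx (mxset J J M) *m cvset J qbar).
  rewrite -[LHS](mulKmx MJ) -mulmxN; congr (_ *m _).
  rewrite (@mul_mxsub_supported _ _ _ _ _ _ _ id J) => [|i j k /r0 rk].
    apply/matrixP => i j; rewrite ord1 [LHS]mxE !mxE; apply/eqP.
    have [_ +] := res0 _ (JN _ (enum_valP i)); rewrite !mxE => /eqP.
    by rewrite addr_eq0.
  by rewrite ord1 rk mulr0.
have zuJ u : cvset J (affine D r u) =
    - (invmx (mxset J J M) *m cvset J (qfun qbar u)).
  apply: zJ => // i j /DJ0/matrixP c0 iJ.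
  by have := c0 (enum_rank_in iJ i) 0; rewrite !mxE enum_rankK_in.
split; split=> //.
- by move=> i iJ; split; [apply: DJ0|apply: rowD0].
- move=> u uU i; rewrite -zuJ [cvset _ _ _ _]mxE.
  by case: (sol u uU (enum_val i)).
- move=> u uU i; rewrite -mulmxA -mulmxN -zuJ -wN; last exact: z0.
  by rewrite [cvset _ _ _ _]mxE; case: (sol u uU (enum_val i)).
Qed.
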